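(* Let $\Omega\subset\mathbb{R}^d$ be compact, let $p\in(1,\infty)$, and let $V=\{V_j(\Omega)\}_{j\in\mathbb{N}}$ be a multiresolution analysis with properties MRA1), MRA2), MRA3) listed in the context, with projectors $P_j$. Then for every $j\in\mathbb{N}$ there exists $j'\ge j$ large enough such that for every sampling set $\Xi_{j'}=\{\xi_{j',k}\}_{k=0}^{N_{j'}}$ with $\xi_{j',k}\in\operatorname{supp}(\phi_{j',k})$ for all $k$, every function $f_j\in V_j(\Omega)$ can be exactly recovered from its samples $\{f_j(\xi_{j',k})\}_{k=0}^{N_{j'}}$ by the iterative algorithm $$f_j^{(0)}=P_jS_{\Phi_{j'},\Xi_{j'}}f_j,\qquad f_j^{(n+1)}=P_jS_{\Phi_{j'},\Xi_{j'}}(f_j-f_j^{(n)})+f_j^{(n)},\quad n\ge0 .$$ Precisely, $f_j=\lim_{n\to\infty}f_j^{(n)}$ uniformly on $\Omega$, and hence also in $L^q(\Omega)$ for all $q\in[1,\infty]$. Moreover, for every $f\in L^p(\Omega)$, setting $f_j=P_jf$ and letting $f_j^{(n)}$ be defined by the iteration $f_j^{(0)}=P_jS_{\Phi_{j'},\Xi_{j'}}f_j$, $f_j^{(n+1)}=P_jS_{\Phi_{j'},\Xi_{j'}}(f_j-f_j^{(n)})+f_j^{(n)}$, $n\ge0$, from such sampling values $\{f_j(\xi_{j',k})\}_{k=0}^{N_{j'}}$ (for each $j$, with its $j'$), one has $$f=\lim_{j\to\infty}\lim_{n\to\infty}f_j^{(n)}\quad\text{in }L^p(\Omega).$$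
   Context: Setting. $\Omega\subset\mathbb{R}^d$ is compact and $\chi_\Omega$ is the constant function $1$ on $\Omega$. $C^1(\Omega,\mathbb{R}_+)$ denotes the nonnegative continuously differentiable functions on $\Omega$ (restrictions to $\Omega$ of functions that are $C^1$ in a neighbourhood of $\Omega$). MRA1) $V=\{V_j(\Omega)\}_{j\in\mathbb{N}}$ are finite dimensional spaces such that for all $q\in(1,\infty)$: $\chi_\Omega\in V_0(\Omega)\subset V_1(\Omega)\subset\dots\subset V_j(\Omega)\subset\dots\subset L^q(\Omega)$ and $\bigcup_jV_j(\Omega)$ is dense in $L^q(\Omega)$. MRA2) Each $V_j(\Omega)$ has a basis $\Phi_j=\{\phi_{j,0},\dots,\phi_{j,N_j}\}\subset C^1(\Omega,\mathbb{R}_+)$ such that $\Phi_{j-1}=A_j\Phi_j$ for a suitable (stochastic) real scaling matrix $A_j$ of size $(N_{j-1}+1)\times(N_j+1)$, and $2^{-dj/2}\sum_{k=0}^{N_j}\phi_{j,k}\equiv1$ for all $j$. Moreover there are $C>0$ and $m\in\mathbb{N}$, independent of $j$ and $k$, such that $\operatorname{diam}(\operatorname{supp}\phi_{j,k})\le C2^{-j}$, $\#\{k:\operatorname{supp}(\phi_{j,k})\cap\operatorname{supp}(\phi_{j,k'})\ne\emptyset\}\le m$ for all $k'$, and $\|\nabla\phi_{j,k}\|_\infty\le C2^{j(d/2+1)}$. MRA3) For each $j$, $P_j:L^p(\Omega)\to V_j(\Omega)$ is a linear projector ($P_jf=f$ for all $f\in V_j(\Omega)$) which is bounded with respect to the sup-norm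 on bounded functions (in particular from $C(\Omega)$ to $V_j(\Omega)$, both with the sup-norm), and $f=\lim_{j\to\infty}P_jf$ in $L^p(\Omega)$ for all $f\in L^p(\Omega)$. Quasi-interpolation operator. For $j\in\mathbb{N}$ and $\Xi_j=\{\xi_{j,k}\}_{k=0}^{N_j}$ with $\xi_{j,k}\in\operatorname{supp}(\phi_{j,k})$, $$S_{\Phi_j,\Xi_j}f=2^{-dj/2}\sum_{k=0}^{N_j}f(\xi_{j,k})\phi_{j,k},\qquad f\in C(\Omega).$$ *)

(* Defs.v *)
From HB Require Import structures.
From mathcomp Require Import all_boot all_order all_algebra.
From mathcomp Require Import all_classical all_reals all_analysis.

Set Implicit Arguments.
Unset Strict Implicit.
Unset Printing Implicit Defensive.

Import Order.TTheory GRing.Theory Num.Theory.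
Import numFieldNormedType.Exports.

Local Open Scope classical_set_scope.
Local Open Scope ring_scope.

Definition measure_rV_display : measure_display -> measure_display.
Proof. exact. Qed.

(* The sigma-algebra generated by the coordinates; for finite n this is the
   Borel sigma-algebra of R^n. *)
Section measurable_rV.
Context {d : measure_display} {T : sigmaRingType d} (n : nat).

Let coord (i : 'I_n) (x : 'rV[T]_n) : T := x ord0 i.

Let rV_set0 : g_sigma_preimage coord set0.
Proof. exact: sigma_algebra0. Qed.

Let rV_setC A : g_sigma_preimage coord A -> g_sigma_preimage coord (~` A).
Proof. exact: sigma_algebraC. Qed.

Let rV_bigcup (F : _^nat) : (forall i, g_sigma_preimage coord (F i)) ->
  g_sigma_preimage coord (\bigcup_i (F i)).
Proof. exact: sigma_algebra_bigcup. Qed.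

HB.instance Definition _ := @isMeasurable.Build (measure_rV_display d)
  'rV[T]_n (g_sigma_preimage coord) rV_set0 rV_setC rV_bigcup.

End measurable_rV.

Lemma measurable_coord (d : measure_display) (T : sigmaRingType d) (n : nat)
  (i : 'I_n) : measurable_fun [set: 'rV[T]_n] (fun x : 'rV[T]_n => x ord0 i).
Proof.
move=> _ Y mY; rewrite setTI; apply: sub_sigma_algebra => /=.
rewrite -bigcup_seq/=; exists i => /=; first by rewrite mem_index_enum.
by exists Y => //; rewrite setTI.
Qed.

Lemma measurable_fun_rV (d d' : measure_display) (S : measurableType d)
  (T : measurableType d') (n : nat) (f : S -> 'rV[T]_n) :
  (forall i, measurable_fun [set: S] (fun x => f x ord0 i)) ->
  measurable_fun [set: S] f.
Proof.
move=> mf _ A mA; rewrite setTI.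
have := g_sigma_preimage_comp (fun (i : 'I_n) (x : 'rV[T]_n) => x ord0 i) f.
move=> E; have : g_sigma_preimage
    (fun i : 'I_n => (fun x : 'rV[T]_n => x ord0 i) \o f) (f @^-1` A).
  by rewrite E; exists A => //; rewrite setTI.
suff : g_sigma_preimage (fun i : 'I_n => (fun x : 'rV[T]_n => x ord0 i) \o f)
    `<=` measurable by apply.
apply: smallest_sub; first exact: sigma_algebra_measurable.
rewrite -bigcup_seq; apply: bigcup_sub => i _.
by move=> B [C mC <-]; exact: mf.
Qed.

Section lebesgue_step.
Context {R : realType} (n : nat).

Definition rV_cons (xv : measurableTypeR R * 'rV[R]_n) : 'rV[R]_n.+1 :=
  \row_i oapp (xv.2 ord0) xv.1 (unlift ord0 i).

Definition rV_uncons (x : 'rV[R]_n.+1) : measurableTypeR R * 'rV[R]_n :=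
  (x ord0 ord0, \row_i x ord0 (lift ord0 i)).

Lemma rV_consK : cancel rV_cons rV_uncons.
Proof.
move=> [x v]; rewrite /rV_uncons /rV_cons !mxE unlift_none /=; congr pair.
by apply/rowP => i; rewrite !mxE liftK.
Qed.

Lemma measurable_rV_cons : measurable_fun setT rV_cons.
Proof.
apply: measurable_fun_rV => i.
under eq_fun do rewrite mxE.
case: (unliftP ord0 i) => [j|] _ /=; last exact: measurable_fst.
exact: (measurableT_comp (measurable_coord j) measurable_snd).
Qed.

Lemma measurable_rV_uncons : measurable_fun setT rV_uncons.
Proof.
apply/measurable_fun_pairP; split; first exact: measurable_coord.
apply: measurable_fun_rV => i.
under eq_fun do rewrite mxE.
exact: measurable_coord.
Qed.

Variable mu : {sigma_finite_measure set 'rV[R]_n -> \bar R}.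

Definition lebesgue_step : set 'rV[R]_n.+1 -> \bar R :=
  pushforward (lebesgue_measure \x mu)%E rV_cons.

Let mcons (A : set 'rV[R]_n.+1) : measurable A -> measurable (rV_cons @^-1` A).
Proof. by move=> mA; rewrite -[X in measurable X]setTI; exact: measurable_rV_cons. Qed.

Let lebesgue_step0 : lebesgue_step set0 = 0%E.
Proof. by rewrite /lebesgue_step /pushforward preimage_set0 measure0. Qed.

Let lebesgue_step_ge0 A : (0 <= lebesgue_step A)%E.
Proof. by rewrite /lebesgue_step /pushforward measure_ge0. Qed.

Let lebesgue_step_additive : semi_sigma_additive lebesgue_step.
Proof.
move=> F mF tF mUF; rewrite /lebesgue_step /pushforward preimage_bigcup.
apply: measure_semi_sigma_additive.
- by move=> k; exact: mcons.
- apply/trivIsetP => /= i j _ _ ij; rewrite -preimage_setI.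
  by move/trivIsetP : tF => /(_ _ _ _ _ ij) ->//; rewrite preimage_set0.
- by rewrite -preimage_bigcup; exact: mcons.
Qed.

HB.instance Definition _ := isMeasure.Build _ _ _ lebesgue_step
  lebesgue_step0 lebesgue_step_ge0 lebesgue_step_additive.

Let lebesgue_step_sigma_finite : sigma_finite setT lebesgue_step.
Proof.
have /sigma_finiteP[F [TF ndF Foo]] := sigma_finiteT (@lebesgue_measure R).
have /sigma_finiteP[G [TG ndG Goo]] := sigma_finiteT mu.
exists (fun k => rV_uncons @^-1` (F k `*` G k)).
  rewrite -preimage_bigcup -(preimage_setT rV_uncons); congr preimage.
  rewrite -setXTT TF TG predeqE => -[x y]; split.
    move=> [/= [k _ Fkx] [l _ Gly]]; exists (maxn k l) => //; split.
    - by move: x Fkx; exact/subsetPset/ndF/leq_maxl.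
    - by move: y Gly; exact/subsetPset/ndG/leq_maxr.
  by move=> [k _ []/= ? ?]; split; exists k.
move=> k; have [mF Fk] := Foo k; have [mG Gk] := Goo k.
split.
  rewrite -[X in measurable X]setTI; apply: measurable_rV_uncons => //.
  exact: measurableX.
rewrite /lebesgue_step /pushforward -comp_preimage.
rewrite (_ : rV_uncons \o rV_cons = id); last exact/funext/rV_consK.
rewrite preimage_id.
by rewrite product_measure1E// lte_mul_pinfty// ge0_fin_numE.
Qed.

HB.instance Definition _ := @Measure_isSigmaFinite.Build _ _ _ lebesgue_step
  lebesgue_step_sigma_finite.

End lebesgue_step.

Fixpoint lebesgue_rV (R : realType) (n : nat) :
    {sigma_finite_measure set 'rV[R]_n -> \bar R} :=
  if n is n'.+1 then lebesgue_step (lebesgue_rV R n') else \d_(0 : 'rV[R]_0).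

Lemma measurable_rV_box (R : realType) (n : nat) (a b : 'rV[R]_n) :
  measurable [set x : 'rV[R]_n | forall i, a ord0 i <= x ord0 i <= b ord0 i].
Proof.
rewrite (_ : mkset _ = \big[setI/setT]_(i < n)
    ((fun x : 'rV[R]_n => x ord0 i) @^-1` `[a ord0 i, b ord0 i])); last first.
  rewrite -bigcap_seq; apply/seteqP; split => [x abx i _|x abx i] /=.
    by rewrite in_itv/=; exact: abx.
  by have := abx i; rewrite /= in_itv/=; apply; rewrite mem_index_enum.
apply: bigsetI_measurable => i _; rewrite -[X in measurable X]setTI.
exact: measurable_coord.
Qed.

Lemma lebesgue_rV_box (R : realType) (n : nat) (a b : 'rV[R]_n) :
  (forall i, a ord0 i <= b ord0 i) ->
  lebesgue_rV R n [set x | forall i, a ord0 i <= x ord0 i <= b ord0 i] =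
  (\prod_(i < n) (b ord0 i - a ord0 i))%:E.
Proof.
elim: n => [|n IHn] in a b * => ab.
  by rewrite big_ord0 /= diracE mem_set// => -[].
rewrite big_ord_recl EFinM /= /lebesgue_step /pushforward.
pose u (x : 'rV[R]_n.+1) : 'rV[R]_n := \row_i x ord0 (lift ord0 i).
have box' : [set x : 'rV[R]_n | forall i, u a ord0 i <= x ord0 i <= u b ord0 i]
    = [set x | forall i, a ord0 (lift ord0 i) <= x ord0 i <= b ord0 (lift ord0 i)].
  by apply/seteqP; split => x /= + i => /(_ i); rewrite !mxE.
rewrite (_ : _ @^-1` _ = `[a ord0 ord0, b ord0 ord0] `*`
  [set x : 'rV[R]_n | forall i, u a ord0 i <= x ord0 i <= u b ord0 i]).
  rewrite product_measure1E//; last exact: measurable_rV_box.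
  rewrite IHn; last by move=> i; rewrite !mxE.
  congr (_ * _)%E; last by congr EFin; apply: eq_bigr => i _; rewrite !mxE.
  transitivity (@lebesgue_measure R `[a ord0 ord0, b ord0 ord0]) => //.
  rewrite lebesgue_measure_itv/= lte_fin.
  by case: ltgtP (ab ord0) => // -> _; rewrite subrr.
rewrite box'; apply/seteqP; split => [[x v]/= h|[x v]/= [xab h] i].
  split; first by have := h ord0; rewrite mxE unlift_none in_itv.
  by move=> i; have := h (lift ord0 i); rewrite mxE liftK.
rewrite mxE; case: (unliftP ord0 i) => [j|] -> /=; first exact: h.
by move: xab; rewrite in_itv.
Qed.

Section euclidean.
Context {R : realType} {d : nat}.

(* The library norm on 'rV[R]_d is the sup norm. *)
Definition enorm (x : 'rV[R]_d) : R := Num.sqrt (\sum_(i < d) x ord0 i ^+ 2).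

Definition diam (A : set 'rV[R]_d) : \bar R :=
  ereal_sup [set (enorm (x - y))%:E | x in A & y in A].

Definition partial (i : 'I_d) (g : 'rV[R]_d -> R) : 'rV[R]_d -> R :=
  'D_(delta_mx ord0 i) g.

Definition gradient (g : 'rV[R]_d -> R) (x : 'rV[R]_d) : 'rV[R]_d :=
  \row_i partial i g x.

Definition C1_near (K : set 'rV[R]_d) (g : 'rV[R]_d -> R) : Prop :=
  exists U : set 'rV[R]_d, [/\ open U, K `<=` U &
    forall x, U x -> differentiable g x /\
      forall i, {for x, continuous (partial i g)}].

End euclidean.

(* Functions on Omega are functions on the subtype [set_type Omega], which
   carries the topology induced by R^d. *)
Section functions_on_Omega.
Context {R : realType} {d : nat} (Omega : set 'rV[R]_d).
Implicit Types (f g : Omega -> R) (q : \bar R) (u : nat -> Omega -> R).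

Definition C1_extension f (h : 'rV[R]_d -> R) : Prop :=
  C1_near Omega h /\ sigL Omega h = f.

Definition C1_nonneg : set (Omega -> R) :=
  [set f | (exists h, C1_extension f h) /\ forall x, 0 <= f x].

Definition supp f : set Omega := closure [set x | f x != 0].

(* Suprema are taken in R, so this is the sup norm for bounded f only. *)
Definition bounded f : Prop := exists M : R, forall x, `|f x| <= M.
Definition supnorm f : R := sup [set `|f x| | x in [set: Omega]].

Definition zero_ext f : 'rV[R]_d -> R := 'valL_(0 : R) f.

(* L^q(Omega), for Lebesgue measure restricted to Omega, is presented by
   representatives, identified when they agree almost everywhere ([Lq_eq]). *)
Definition Lq q : set (Omega -> R) :=
  [set f | zero_ext f \in Lfun (lebesgue_rV R d) q].

Definition Lq_eq f g : Prop :=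
  zero_ext f = zero_ext g %[ae lebesgue_rV R d].

Definition Lq_norm q f : \bar R :=
  'N[lebesgue_rV R d]_q [EFin \o zero_ext f]%E.

Definition Lq_cvg q u f : Prop :=
  [/\ forall n, Lq q (u n), Lq q f &
      Lq_norm q (u n - f) @[n --> \oo] --> 0%E].

Definition lincomb n (b : 'I_n -> Omega -> R) (c : 'I_n -> R) : Omega -> R :=
  \sum_(k < n) c k *: b k.

Definition spans n (b : 'I_n -> Omega -> R) (W : set (Omega -> R)) : Prop :=
  forall f, W f <-> exists c, f = lincomb b c.

Definition finite_dim_space (W : set (Omega -> R)) : Prop :=
  exists n (b : 'I_n -> Omega -> R), spans b W.

Definition is_basis n (b : 'I_n -> Omega -> R) (W : set (Omega -> R)) : Prop :=
  spans b W /\ forall c, lincomb b c = 0 -> forall k, c k = 0.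

End functions_on_Omega.

Section MRA.
Context {R : realType} {d : nat} (Omega : set 'rV[R]_d).
Variables (V : nat -> set (Omega -> R)) (N : nat -> nat).
Variable Phi : forall j, 'I_(N j).+1 -> Omega -> R.
Arguments Phi : clear implicits.

Record MRA1 : Prop := {
  MRA1_finite_dim : forall j, finite_dim_space (V j) ;
  MRA1_one : V 0 (cst 1) ;
  MRA1_nested : forall j, V j `<=` V j.+1 ;
  MRA1_Lq : forall (q : R) j, 1 < q -> V j `<=` Lq q%:E ;
  MRA1_dense : forall (q : R) (f : Omega -> R) (e : R),
    1 < q -> Lq q%:E f -> 0 < e ->
    exists j g, V j g /\ (Lq_norm q%:E (f - g)%R < e%:E)%E
}.

(* With the normalisation [MRA2_unity] the columns of a scaling matrix sum to
   2^(-d/2): what is (column-)stochastic is 2^(d/2) A. *)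
Definition stochastic_scaling m n (A : 'M[R]_(m, n)) : Prop :=
  (forall k l, 0 <= A k l) /\
  forall l, \sum_(k < m) 2 `^ (d%:R / 2) * A k l = 1.

Record MRA2 : Prop := {
  MRA2_basis : forall j, is_basis (Phi j) (V j) ;
  MRA2_C1 : forall j k, C1_nonneg (Phi j k) ;
  MRA2_scaling : forall j, exists A : 'M[R]_((N j).+1, (N j.+1).+1),
    stochastic_scaling A /\
    forall k, Phi j k = \sum_(l < (N j.+1).+1) A k l *: Phi j.+1 l ;
  MRA2_unity : forall j,
    2 `^ (- (d * j)%:R / 2) *: (\sum_(k < (N j).+1) Phi j k) = cst 1 ;
  MRA2_local : exists (C : R) (m : nat), [/\ 0 < C,
    (forall j k, (diam (set_val @` supp (Phi j k)) <= (C * 2 `^ (- j%:R))%:E)%E),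
    (forall j k', (#|[pred k | `[< supp (Phi j k) `&` supp (Phi j k') !=set0 >]]|
                     <= m)%N) &
    (* the gradient on Omega is that of a C^1 extension *)
    (forall j k, exists2 h, C1_extension (Phi j k) h &
       forall x, Omega x ->
         enorm (gradient h x) <= C * 2 `^ (j%:R * (d%:R / 2 + 1)))]
}.

(* P j acts on representatives; [MRA3_class] makes it a map on L^p(Omega). *)
Record MRA3 (p : R) (P : nat -> (Omega -> R) -> Omega -> R) : Prop := {
  MRA3_range : forall j f, Lq p%:E f -> V j (P j f) ;
  MRA3_class : forall j f g, Lq p%:E f -> Lq p%:E g -> Lq_eq f g ->
    P j f = P j g ;
  MRA3_linear : forall j (a : R) f g, Lq p%:E f -> Lq p%:E g ->
    P j (a *: f + g) = a *: P j f + P j g ;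
  MRA3_proj : forall j f, V j f -> P j f = f ;
  MRA3_bounded : forall j, exists M : R, forall f, Lq p%:E f -> bounded f ->
    bounded (P j f) /\ supnorm (P j f) <= M * supnorm f ;
  MRA3_cvg : forall f, Lq p%:E f -> Lq_cvg p%:E (fun j => P j f) f
}.

Definition sampling_set j (Xi : 'I_(N j).+1 -> Omega) : Prop :=
  forall k, supp (Phi j k) (Xi k).

Definition quasi_interp j (Xi : 'I_(N j).+1 -> Omega) (f : Omega -> R) :
    Omega -> R :=
  2 `^ (- (d * j)%:R / 2) *: (\sum_(k < (N j).+1) f (Xi k) *: Phi j k).

Fixpoint reconstruction (Pj S : (Omega -> R) -> Omega -> R) (f : Omega -> R)
    (n : nat) : Omega -> R :=
  if n is n'.+1 then
    Pj (S (f - reconstruction Pj S f n')) + reconstruction Pj S f n'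
  else Pj (S f).

End MRA.

(* Main.v *)
(** Write [S] for the quasi-interpolation operator at level [j']. By the
partition of unity, [S f x - f x] is an average of differences
[f (Xi k) - f x] with [|Xi k - x| <= C 2^-j']. The basis functions of [V j] are
uniformly continuous and, [V j] being finite dimensional, the coefficients of
[f] are controlled by its sup norm; hence for [j'] large [|S f - f| <= e |f|] on
[V j] in sup norm. Composing with the bounded projector [P j], which fixes
[V j], makes [id - P j S] a contraction of [V j] of ratio 1/2, and its iterates
on [f] are the errors of the algorithm. Convergence in L^q follows since
[Omega] has finite measure. In the last claim, the inner limit is [P j f]. *)

Require Import Defs.
From mathcomp Require Import all_boot all_order all_algebra.
From mathcomp Require Import all_classical all_reals all_analysis.
From mathcomp Require Import measurable_realfun ess_sup_inf ring.

Set Implicit Arguments.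
Unset Strict Implicit.
Unset Printing Implicit Defensive.

Import Order.TTheory GRing.Theory Num.Theory.
Import numFieldNormedType.Exports.

Local Open Scope classical_set_scope.
Local Open Scope ring_scope.

(** * Coefficient bounds for finite linearly independent families *)

(* The points [x i] are chosen so as to maximise the rank of the matrix of
   values of the [b k]. *)
Lemma dual_evaluations (F : fieldType) (T : Type) n (b : 'I_n -> T -> F) :
  (forall c : 'I_n -> F, (forall x, \sum_k c k * b k x = 0) -> forall k, c k = 0) ->
  exists m (x : 'I_m -> T) (B : 'M[F]_(n, m)),
    forall (c : 'I_n -> F) k, c k = \sum_i B k i * \sum_l c l * b l (x i).
Proof.
move=> bfree.
pose ev (x : T) : 'rV[F]_n := \row_k b k x.
pose A m (x : 'I_m -> T) : 'M[F]_(m, n) := \matrix_(i, k) b k (x i).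
pose Q r := `[< exists m (x : 'I_m -> T), \rank (A m x) = r >].
have exQ : exists r, Q r.
  pose x0 (i : 'I_0) : T := match i with Ordinal _ h => False_rect T (notF h) end.
  by exists (\rank (A 0 x0)); apply/asboolP; exists 0, x0.
have ubQ r : Q r -> (r <= n)%N.
  by move=> /asboolP[m [x <-]]; exact: rank_leq_col.
case: (ex_maxnP exQ ubQ) => r /asboolP[m [x rkA]] maxr.
(* The rank is already maximal, so adjoining a point [y] cannot enlarge the row space. *)
have evA y : (ev y <= A m x)%MS.
  pose x' (i : 'I_(m + 1)) := match fintype.split i with inl i => x i | inr _ => y end.
  have A'E : A _ x' = col_mx (A m x) (ev y).
    apply/matrixP => i k; rewrite !mxE /x'.
    by case: fintype.split => i'; rewrite !mxE.
  have Q' : Q (\rank (A _ x')) by apply/asboolP; exists (m + 1)%N, x'.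
  have := maxr _ Q'; rewrite A'E -addsmxE -rkA => le_rk.
  apply: submx_trans (addsmxSr (A m x) (ev y)) _.
  by rewrite -(mxrank_leqif_sup (addsmxSl (A m x) (ev y))).2 eqn_leq mxrankS ?addsmxSl.
(* A column of the cokernel is the coefficient vector of a combination vanishing at every point,
   hence zero by freeness; [B] is then a left inverse of [A m x]. *)
have /row_fullP[B BA] : row_full (A m x).
  rewrite -sub1mx submxE mul1mx; apply/eqP/matrixP => i j; rewrite [RHS]mxE.
  apply: (bfree (fun k => cokermx (A m x) k j)) => y.
  have /eqP/matrixP/(_ 0 j) : ev y *m cokermx (A m x) == 0.
    by rewrite -submxE.
  rewrite mxE [RHS]mxE => h; rewrite -[RHS]h; apply: eq_bigr => k _.
  by rewrite [ev _ _ _]mxE mulrC.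
exists m, x, B => c k.
have := congr1 (fun M => (M *m \col_l c l) k ord0) BA.
rewrite /= mul1mx -mulmxA [RHS]mxE => <-; rewrite mxE; apply: eq_bigr => i _.
by rewrite mxE; congr (_ * _); apply: eq_bigr => l _; rewrite !mxE mulrC.
Qed.

(** By [dual_evaluations], each coefficient is a fixed linear combination of finitely many values,
    so [K] can be the sum of all [|B k i|]. *)
Lemma coef_bound (R : realFieldType) (T : Type) n (b : 'I_n -> T -> R) :
  (forall c : 'I_n -> R, (forall x, \sum_k c k * b k x = 0) -> forall k, c k = 0) ->
  exists2 K : R, 0 <= K & forall (c : 'I_n -> R) M, 0 <= M ->
    (forall x, `|\sum_k c k * b k x| <= M) -> forall k, `|c k| <= K * M.
Proof.
move=> /dual_evaluations[m [x [B cE]]].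
exists (\sum_k \sum_i `|B k i|) => [|c M M0 cM k].
  by apply: sumr_ge0 => k _; apply: sumr_ge0 => i _.
rewrite (cE c k) (le_trans (ler_norm_sum _ _ _))//.
apply: (@le_trans _ _ ((\sum_i `|B k i|) * M)).
  rewrite mulr_suml; apply: ler_sum => i _.
  by rewrite normrM ler_wpM2l.
rewrite ler_wpM2r// (bigD1 k)//= lerDl.
by apply: sumr_ge0 => l _; apply: sumr_ge0 => i _.
Qed.

(** * Uniform continuity on compact sets, for the sup norm of R^d *)

Section near_uniform_continuity.
Context {R : realType} {d : nat}.

(** Converts the Euclidean diameter bound of [MRA2] to the sup norm used for uniform continuity. *)
Lemma norm_le_enorm (x : 'rV[R]_d) : `|x| <= enorm x.
Proof.
rewrite /Num.norm/= mx_normrE; apply: bigmax_le => [|[i k] _]; first exact: sqrtr_ge0.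
rewrite ord1/= -sqrtr_sqr ler_sqrt ?sumr_ge0//; last by move=> ? _; exact: sqr_ge0.
by rewrite (bigD1 k)//= lerDl sumr_ge0// => ? _; exact: sqr_ge0.
Qed.

Lemma near_unif_continuous (K : set 'rV[R]_d) (h : 'rV[R]_d -> R) (e : R) :
  compact K -> (forall x, K x -> {for x, continuous h}) -> 0 < e ->
  \forall r \near 0^'+, forall x y, K x -> K y -> `|x - y| <= r ->
    `|h x - h y| <= e.
Proof.
move=> /compact_near_coveringP Kcov hc e0.
have : \forall r \near 0^'+, K `<=`
    [set x | forall y, `|x - y| <= r -> `|h x - h y| <= e].
  apply: Kcov => x Kx.
  have /cvgrPdist_le/(_ (e / 2)) := hc x Kx.
  rewrite divr_gt0// => /(_ isT) /nbhs_ballP[s /= s0 hs].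
  (* With [z] within [s / 2] of [x] and [|z - y| <= r < s / 2], both [z] and [y] are within [s] of
     [x], where [h] differs from [h x] by at most [e / 2]. *)
  exists (ball x (s / 2), [set r : R | 0 < r < s / 2]).
    split => /=; first by apply: nbhsx_ballx; rewrite divr_gt0.
    near=> r; apply/andP; split => //.
    by near: r; apply: nbhs_right_lt; rewrite divr_gt0.
  move=> [z r] [/= xz /andP[r0 rs]] y zyr.
  have hxz : `|h x - h z| <= e / 2.
    by apply: hs; apply: le_ball xz; rewrite [leRHS]splitr lerDl divr_ge0// ltW.
  have hxy : `|h x - h y| <= e / 2.
    apply: hs; rewrite (splitr s); apply: ball_triangle xz _.
    by rewrite -ball_normE/=; exact: le_lt_trans rs.
  rewrite (splitr e) (le_trans _ (lerD hxz hxy))// (distrC (h x) (h z)).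
  exact: ler_distD.
by apply: filterS => r Kr x y Kx _; exact: Kr.
Unshelve. all: by end_near. Qed.

End near_uniform_continuity.

(** * L^q norms under pointwise domination *)

Section Lnorm_monotone.
Local Open Scope ereal_scope.

Lemma le_Lnorm (dT : measure_display) (T : measurableType dT) (R : realType)
    (mu : {measure set T -> \bar R}) (q : \bar R) (f g : T -> R) :
  1 <= q -> measurable_fun setT f -> measurable_fun setT g ->
  (forall x, `|f x| <= `|g x|)%R ->
  'N[mu]_q[EFin \o f] <= 'N[mu]_q[EFin \o g].
Proof.
move=> q1 mf mg fg; rewrite unlock /Lnorm; case: q q1 => [r r1| _|//].
  have r0 : (0 < r)%R by rewrite (lt_le_trans ltr01)// -lee_fin.
  have mr (h : T -> R) : measurable_fun setT h ->
      measurable_fun setT (fun x : T => (`|h x| `^ r)%R).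
    move=> mh; apply: (@measurableT_comp _ _ _ _ _ _ (@powR R ^~ r)) => //.
    exact: measurableT_comp.
  apply: gt0_ler_poweR; rewrite ?invr_ge0 ?(ltW r0)// ?in_itv/= ?leey ?andbT;
    try by apply: integral_ge0 => x _; rewrite lee_fin powR_ge0.
  apply: ge0_le_integral => //=.
  - by apply/measurable_EFinP; exact: mr.
  - by apply/measurable_EFinP; exact: mr.
  - by move=> x _; rewrite lee_fin ge0_ler_powR// ?nnegrE// ltW.
case: ifPn => // _; apply: le_ess_sup.
by apply: nearW => x /=; rewrite lee_fin.
Qed.

End Lnorm_monotone.

(** * Bounded functions on [Omega]: L^q membership and uniform convergence *)

Section bounded_functions_on_Omega.
Context {R : realType} {d : nat} (Omega : set 'rV[R]_d).
Implicit Types (f g : Omega -> R) (q : \bar R).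

Lemma zero_ext_val f (x : Omega) : zero_ext f (set_val x) = f x.
Proof. by have := congr1 (fun h => h x) (valLK (0 : R) f). Qed.

Lemma zero_ext_out f (x : 'rV[R]_d) : ~ Omega x -> zero_ext f x = 0.
Proof.
move=> nx; rewrite /zero_ext /valL_/= oinv_set_val insubN//.
by apply/negP => /set_mem.
Qed.

Lemma zero_extB f g : zero_ext (f - g) = zero_ext f - zero_ext g.
Proof.
apply/funext => x; have [Ox|nOx] := pselect (Omega x); last first.
  by rewrite !fctE !zero_ext_out// subr0.
have -> : x = set_val (SigSub (mem_set Ox)) by [].
by rewrite !fctE !zero_ext_val.
Qed.

(** The right-hand side is [M] times the indicator of [Omega], in the shape required by
    [le_Lnorm]. *)
Lemma norm_zero_ext_le f (M : R) : (forall x, `|f x| <= M) ->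
  forall x, `|zero_ext f x| <= `|M * zero_ext (cst 1%R : Omega -> R) x|.
Proof.
move=> fM x; have [Ox|nOx] := pselect (Omega x); last first.
  by rewrite !zero_ext_out// normr0.
have -> : x = set_val (SigSub (mem_set Ox)) by [].
by rewrite !zero_ext_val mulr1 (le_trans (fM _))// ler_norm.
Qed.

(** The zero extension of 1 is an indicator: its positive powers all have the same integral, so one
    finite exponent decides them all, and its essential supremum is at most 1. *)
Lemma Lq_one (r : R) q : 1 < r -> (1 <= q)%E ->
  Lq r%:E (cst 1%R : Omega -> R) -> Lq q (cst 1%R : Omega -> R).
Proof.
move=> r1 q1 /andP[m1 /[!inE] N1]; rewrite /Lq/= inE m1/= inE.
move: N1; rewrite /finLfun/= /finite_norm; set h := zero_ext _.
have hP x : h x = 0 \/ h x = 1.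
  have [Ox|nOx] := pselect (Omega x); last by left; rewrite /h zero_ext_out.
  right; have -> : x = set_val (SigSub (mem_set Ox)) by [].
  by rewrite /h zero_ext_val.
have r0 : 0 < r by rewrite (lt_trans ltr01).
case: q q1 => [s s1| _|//]; last first.
  move=> _; rewrite unlock /Lnorm; case: ifPn => // _.
  apply: (@le_lt_trans _ _ 1%E); last exact: ltry.
  apply/ess_supP/nearW => x /=; rewrite lee_fin.
  by case: (hP x) => ->; rewrite ?normr0 ?normr1.
have s0 : 0 < s by rewrite (lt_le_trans ltr01)// -lee_fin.
rewrite unlock /Lnorm => /lty_poweRy.
rewrite invr_eq0 gt_eqF// => /(_ isT) I1; apply: poweR_lty.
(* The exponents [s] and [r] are positive, so both powers of 0 are 0 and the integrands agree. *)
rewrite (eq_integral (fun x => `|(EFin \o h) x| `^ r)%E)// => x _ /=.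
by case: (hP x) => ->; rewrite ?normr0 ?normr1 ?powR1// !powR0 ?gt_eqF.
Qed.

Lemma Lq_norm_le f q (M : R) : (1 <= q)%E -> Lq q (cst 1%R : Omega -> R) ->
  measurable_fun setT (zero_ext f) -> (forall x, `|f x| <= M) -> 0 <= M ->
  (Lq_norm q f <= M%:E * Lq_norm q (cst 1%R : Omega -> R))%E.
Proof.
move=> q1 L1 mf fM M0.
have := LnormZ (Lfun_Sub q1 L1) M; rewrite /= ger0_norm// => <-.
have m1 : measurable_fun setT (zero_ext (cst 1%R : Omega -> R)).
  by move: L1 => /andP[+ _]; rewrite inE.
apply: le_Lnorm => //; first exact: measurable_funM.
exact: norm_zero_ext_le.
Qed.

Lemma bounded_Lq f q : (1 <= q)%E -> Lq q (cst 1%R : Omega -> R) ->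
  measurable_fun setT (zero_ext f) -> bounded f -> Lq q f.
Proof.
move=> q1 L1 mf [M fM].
have fM' x : `|f x| <= `|M| by rewrite (le_trans (fM x))// ler_norm.
apply/andP; split; rewrite inE//= /finite_norm.
apply: le_lt_trans (Lq_norm_le q1 L1 mf fM' (normr_ge0 _)) _.
apply: lte_mul_pinfty; rewrite ?lee_fin//.
by move: L1 => /andP[_]; rewrite inE.
Qed.

Lemma uniform_cvgP (u : nat -> Omega -> R) f :
  {uniform, u n @[n --> \oo] --> f} <->
  forall e : R, 0 < e -> \forall n \near \oo, forall x, `|f x - u n x| <= e.
Proof.
split => [uf e e0|uf].
  have : nbhs (f : {uniform Omega -> R}) [set h | forall x, `|f x - h x| <= e].
    apply/uniform_nbhs; exists [set xy : R * R | `|xy.1 - xy.2| <= e]; split.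
      by rewrite -entourage_from_ballE; exists e => // -[a b] /ltW.
    by move=> h hE x; exact: hE.
  by move=> /uf.
move=> A /uniform_nbhs[E [+ EA]].
rewrite -entourage_from_ballE => -[e /= e0 eE].
(* Halving [e] turns the non-strict bound into the strict one that defines a ball. *)
have e2 : 0 < e / 2 by rewrite divr_gt0.
apply: filterS (uf _ e2) => n un; apply: EA => x _; apply: eE => /=.
rewrite -ball_normE/= (le_lt_trans (un x))// ltr_pdivrMr// ltr_pMr//.
by rewrite ltr1n.
Qed.

(** By [Lq_norm_le], the L^q norm of the error is at most its uniform bound times the finite norm of
    1. *)
Lemma uniform_Lq_cvg (u : nat -> Omega -> R) f q :
  (1 <= q)%E -> Lq q (cst 1%R : Omega -> R) ->
  (forall n, measurable_fun setT (zero_ext (u n))) -> (forall n, bounded (u n)) ->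
  measurable_fun setT (zero_ext f) -> bounded f ->
  {uniform, u n @[n --> \oo] --> f} -> Lq_cvg q u f.
Proof.
move=> q1 L1 mu bu mf bf /uniform_cvgP uf.
split => [n||]; [exact: bounded_Lq|exact: bounded_Lq|].
have N1fin : Lq_norm q (cst 1%R : Omega -> R) \is a fin_num.
  rewrite ge0_fin_numE ?Lnorm_ge0//.
  by move: L1 => /andP[_]; rewrite inE.
set N1 := fine (Lq_norm q (cst 1%R : Omega -> R)).
have N1_ge0 : 0 <= N1 by rewrite fine_ge0// Lnorm_ge0.
have key (e : R) : 0 < e ->
    \forall n \near \oo, (Lq_norm q (u n - f)%R <= e%:E)%E.
  (* Adding 1 keeps the divisor positive when [N1 = 0], as for a null [Omega]. *)
  move=> e0; have N1p : 0 < N1 + 1 by rewrite ltr_wpDl.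
  have eN : 0 < e / (N1 + 1) by rewrite divr_gt0.
  apply: filterS (uf _ eN) => n un.
  apply: le_trans (Lq_norm_le q1 L1 _ _ (ltW eN)) _.
  - by rewrite zero_extB; exact: measurable_funB.
  - by move=> x; rewrite !fctE distrC.
  - rewrite -(fineK N1fin) -EFinM lee_fin -/N1 -mulrA ler_piMr ?(ltW e0)//.
    by rewrite mulrC ler_pdivrMr// mul1r lerDl.
have key0 n : (0 <= Lq_norm q (u n - f)%R)%E by exact: Lnorm_ge0.
apply/fine_cvgP; split.
  apply: filterS (key 1 ltr01) => n h; rewrite ge0_fin_numE//.
  exact: le_lt_trans h (ltry _).
apply/cvgrPdist_le => e e0; apply: filterS (key e e0) => n h /=.
rewrite sub0r normrN ger0_norm ?fine_ge0//.
rewrite -lee_fin fineK// ge0_fin_numE//.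
exact: le_lt_trans h (ltry _).
Qed.

End bounded_functions_on_Omega.

(** * Finite-dimensional function spaces, the sup norm and the error of the iteration *)

Section spaces.
Context {R : realType} {d : nat} (Omega : set 'rV[R]_d).
Implicit Types (f g : Omega -> R) (W : set (Omega -> R)).

Lemma lincombE n (b : 'I_n -> Omega -> R) c x :
  lincomb b c x = \sum_k c k * b k x.
Proof. by rewrite /lincomb fct_sumE. Qed.

Lemma spansD n (b : 'I_n -> Omega -> R) W f g :
  spans b W -> W f -> W g -> W (f + g).
Proof.
move=> bW /bW[c ->] /bW[c' ->]; apply/bW; exists (fun k => c k + c' k).
by rewrite -big_split; apply: eq_bigr => k _; rewrite scalerDl.
Qed.

Lemma spansB n (b : 'I_n -> Omega -> R) W f g :
  spans b W -> W f -> W g -> W (f - g).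
Proof.
move=> bW /bW[c ->] /bW[c' ->]; apply/bW; exists (fun k => c k - c' k).
by rewrite -sumrB; apply: eq_bigr => k _; rewrite scalerBl.
Qed.

Lemma basis_coef_bound n (b : 'I_n -> Omega -> R) W : is_basis b W ->
  exists2 K : R, 0 <= K & forall c M, 0 <= M ->
    (forall x, `|lincomb b c x| <= M) -> forall k, `|c k| <= K * M.
Proof.
move=> [_ bfree]; have [|K K0 KP] := @coef_bound R Omega n b.
  move=> c c0; apply: bfree; apply/funext => x.
  by rewrite lincombE c0.
exists K => // c M M0 cM; apply: KP => // x.
by rewrite -lincombE.
Qed.

Lemma bounded_le_supnorm f : bounded f -> forall x, `|f x| <= supnorm f.
Proof.
move=> [M fM] x; apply: ub_le_sup; last by exists x.
by exists M => _ [y _ <-].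
Qed.

Lemma supnorm_le f (M : R) : 0 <= M -> (forall x, `|f x| <= M) ->
  supnorm f <= M.
Proof.
move=> M0 fM; rewrite /supnorm; set A := [set _ | _ in _].
(* For empty [Omega] the supremum is 0 by convention, and [0 <= M] concludes. *)
have [->|/set0P A0] := eqVneq A set0; first by rewrite sup0.
by apply: ge_sup => // _ [x _ <-].
Qed.

(** The errors satisfy [r_0 = f - Pj (S f)] and [r_(n+1) = r_n - Pj (S r_n)]; the initial step
    already halves the bound, hence the exponent [n.+1]. *)
Lemma reconstruction_error (W : set (Omega -> R))
    (Pj S : (Omega -> R) -> Omega -> R) f (M : R) :
  (forall g h, W g -> W h -> W (g + h)) ->
  (forall g h, W g -> W h -> W (g - h)) ->
  (forall g, W g -> W (Pj (S g))) ->
  (forall g M, 0 <= M -> W g -> (forall x, `|g x| <= M) ->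
    forall x, `|g x - Pj (S g) x| <= M / 2) ->
  0 <= M -> W f -> (forall x, `|f x| <= M) ->
  forall n, W (reconstruction Pj S f n) /\
    forall x, `|f x - reconstruction Pj S f n x| <= M / 2 ^+ n.+1.
Proof.
move=> WD WB WPS PSh M0 Wf fM; elim=> [|n [Wn IHn]] /=.
  by split; [exact: WPS|exact: PSh].
have WB' := WB _ _ Wf Wn.
split=> [|x]; first exact/WD/Wn/WPS.
rewrite fctE opprD addrA addrAC [2 ^+ _]exprSr invfM mulrA.
by apply: (PSh _ (M / 2 ^+ n.+1)) => //; rewrite divr_ge0// exprn_ge0.
Qed.

End spaces.

(** * Approximation by quasi-interpolation on a fixed [V j] *)

Section quasi_interpolation.
Context {R : realType} {d : nat} (Omega : set 'rV[R]_d).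
Variables (V : nat -> set (Omega -> R)) (N : nat -> nat).
Variable Phi : forall j, 'I_(N j).+1 -> Omega -> R.
Arguments Phi : clear implicits.
Hypothesis V2 : MRA2 V Phi.
Implicit Types f : Omega -> R.

Lemma unityE j x : 2 `^ (- (d * j)%:R / 2) * (\sum_k Phi j k x) = 1 :> R.
Proof.
have /(congr1 (fun h => h x)) := MRA2_unity V2 j.
by rewrite fctE fct_sumE.
Qed.

Lemma Phi_ge0 j k x : 0 <= Phi j k x.
Proof. by have [_] := MRA2_C1 V2 k; exact. Qed.

Lemma quasi_interp_in j (Xi : 'I_(N j).+1 -> Omega) f :
  V j (quasi_interp Phi Xi f).
Proof.
have [bV _] := MRA2_basis V2 j; apply/bV.
exists (fun k => 2 `^ (- (d * j)%:R / 2) * f (Xi k)).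
rewrite /quasi_interp scaler_sumr; apply: eq_bigr => k _.
by rewrite scalerA.
Qed.

(** Each [Phi j k] is nonnegative, hence at most the sum of all of them, which is constant by the
    partition of unity. *)
Lemma V_bounded j f : V j f -> bounded f.
Proof.
have [bV _] := MRA2_basis V2 j => /bV[c ->].
exists (\sum_k `|c k| * (2 `^ (- (d * j)%:R / 2))^-1) => x.
rewrite lincombE (le_trans (ler_norm_sum _ _ _))//; apply: ler_sum => k _.
rewrite normrM ler_wpM2l// ger0_norm ?Phi_ge0//.
have p0 : 0 < 2 `^ (- (d * j)%:R / 2) :> R by rewrite powR_gt0.
have -> : (2 `^ (- (d * j)%:R / 2))^-1 = \sum_l Phi j l x.
  by apply: (mulfI (lt0r_neq0 p0)); rewrite unityE mulfV ?gt_eqF.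
rewrite (bigD1 k)//= lerDl sumr_ge0// => i _; exact: Phi_ge0.
Qed.

(** The weights are nonnegative with sum 1, and indices of zero weight at [x] drop out of the
    average. *)
Lemma quasi_interp_sub_le j (Xi : 'I_(N j).+1 -> Omega) f (e : R) x :
  (forall k, Phi j k x != 0 -> `|f (Xi k) - f x| <= e) ->
  `|quasi_interp Phi Xi f x - f x| <= e.
Proof.
move=> fe; pose a : R := 2 `^ (- (d * j)%:R / 2).
have a0 : 0 <= a by exact: powR_ge0.
(* Rewrites a constant as its own weighted average; applied to [f x] and later to [e]. *)
have aE y : y = a * (y * \sum_k Phi j k x) by rewrite mulrCA unityE mulr1.
have -> : quasi_interp Phi Xi f x - f x =
    a * \sum_k (f (Xi k) - f x) * Phi j k x.
  have -> : quasi_interp Phi Xi f x = a * \sum_k f (Xi k) * Phi j k x.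
    by rewrite /quasi_interp fctE fct_sumE.
  rewrite {1}(aE (f x)) -mulrBr; congr (_ * _); rewrite mulr_sumr -sumrB.
  by apply: eq_bigr => k _; rewrite mulrBl.
rewrite normrM (ger0_norm a0) (aE e) ler_wpM2l//.
rewrite mulr_sumr (le_trans (ler_norm_sum _ _ _))//; apply: ler_sum => k _.
rewrite normrM (ger0_norm (Phi_ge0 k x)).
have [->|Pk] := eqVneq (Phi j k x) 0; first by rewrite !mulr0.
by rewrite ler_wpM2r ?Phi_ge0// fe.
Qed.

(** Both [Xi k] and [x] lie in the support of [Phi j k], whose diameter is bounded by
    [MRA2_local]. *)
Lemma sampling_dist :
  exists2 C : R, 0 < C & forall j (Xi : 'I_(N j).+1 -> Omega),
    sampling_set Phi Xi -> forall k x, Phi j k x != 0 ->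
    `|set_val (Xi k) - set_val x| <= C * 2 `^ (- j%:R).
Proof.
have [C [m [C0 Cdiam _ _]]] := MRA2_local V2.
exists C => // j Xi Xis k x Pkx.
rewrite (le_trans (norm_le_enorm _))// -lee_fin (le_trans _ (Cdiam j k))//.
apply: ereal_sup_ubound; exists (set_val (Xi k)); first by exists (Xi k).
by exists (set_val x) => //; exists x => //; exact: subset_closure.
Qed.

Hypothesis Ocpt : compact Omega.

(** The threshold on [j'] comes from the uniform continuity of the finitely many [Phi j k] and from
    the coefficient constant, so it serves all sampling sets and all [f] at once. *)
Lemma near_quasi_interp j (e : R) : 0 < e ->
  \forall j' \near \oo, forall Xi : 'I_(N j').+1 -> Omega,
    sampling_set Phi Xi -> forall f M, V j f -> 0 <= M ->
    (forall x, `|f x| <= M) ->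
    forall x, `|quasi_interp Phi Xi f x - f x| <= e * M.
Proof.
move=> e0; have [K K0 KP] := basis_coef_bound (MRA2_basis V2 j).
have [C C0 CP] := sampling_dist.
(* Chosen so that [(N j).+1] terms of size [(K + 1) * M * e'] add up to [e * M]; [K + 1] avoids a
   zero divisor. *)
pose e' := e / ((N j).+1%:R * (K + 1)).
have K1 : 0 < K + 1 by rewrite ltr_wpDl.
have e'0 : 0 < e' by rewrite divr_gt0// mulr_gt0// ltr0n.
have unif : \forall r \near 0^'+, forall k (x y : Omega),
    `|set_val x - set_val y| <= r -> `|Phi j k x - Phi j k y| <= e'.
  apply: filter_forall => k; have [[h [[U [_ OU hU]] hk]] _] := MRA2_C1 V2 k.
  have hc x : Omega x -> {for x, continuous h}.
    by move=> /OU/hU[+ _]; exact: differentiable_continuous.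
  apply: filterS (near_unif_continuous Ocpt hc e'0) => r hr x y xy.
  by rewrite -hk; apply: hr => //; exact: set_valP.
have C2 : C * 2 `^ (- j'%:R) @[j' --> \oo] --> (0 : R).
  rewrite -(mulr0 C); apply: cvgMr.
  have -> : (fun j' : nat => 2 `^ (- j'%:R) : R) = GRing.exp 2^-1.
    by apply/funext => j'; rewrite powRN powR_mulrn// exprVn.
  apply: cvg_expr; rewrite gtr0_norm ?invr_gt0// invf_lt1// ltr1n.
  by [].
have unif' : \forall j' \near \oo, forall k (x y : Omega),
    `|set_val x - set_val y| <= C * 2 `^ (- j'%:R) ->
    `|Phi j k x - Phi j k y| <= e'.
  (* [unif] concerns only [r > 0], so positivity is needed besides convergence to 0. *)
  near=> j'; have C2j : 0 < C * 2 `^ (- j'%:R) by rewrite mulr_gt0// powR_gt0.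
  by move: C2j; near: j'; exact: (C2 _ unif).
apply: filterS unif' => j' hj' Xi Xis f M Vf M0 fM x.
have [bV _] := MRA2_basis V2 j.
have [c fE] := (bV f).1 Vf.
apply: quasi_interp_sub_le => k Pk.
have cM : forall k, `|c k| <= K * M by apply: KP => // y; rewrite -fE.
rewrite fE !lincombE -sumrB (le_trans (ler_norm_sum _ _ _))//.
apply: (@le_trans _ _ (\sum_(l < (N j).+1) (K + 1) * M * e')).
  apply: ler_sum => l _; rewrite -mulrBr normrM ler_pM//.
    by rewrite (le_trans (cM l))// ler_wpM2r// lerDl.
  by apply: hj'; exact: CP.
rewrite sumr_const card_ord -mulr_natl /e' le_eqVlt; apply/orP; left.
by apply/eqP; field; rewrite gt_eqF//= nat1r pnatr_eq0.
Unshelve. all: by end_near. Qed.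

End quasi_interpolation.

(** * Choice of the level [j'] and convergence of the algorithm *)

Theorem corollary2p3 (R : realType) (d : nat) (Omega : set 'rV[R]_d) (p : R)
    (V : nat -> set (Omega -> R)) (N : nat -> nat)
    (Phi : forall j, 'I_(N j).+1 -> Omega -> R)
    (P : nat -> (Omega -> R) -> Omega -> R) :
  compact Omega -> 1 < p -> MRA1 V -> MRA2 V Phi -> MRA3 V p P ->
  let algo j j' (Xi : 'I_(N j').+1 -> Omega) (f : Omega -> R) (n : nat) :=
    reconstruction (P j) (quasi_interp Phi Xi) f n in
  let recovers j j' :=
    forall Xi : 'I_(N j').+1 -> Omega, sampling_set Phi Xi ->
    forall f, V j f ->
      {uniform, algo j j' Xi f n @[n --> \oo] --> f} /\
      (forall q : \bar R, (1 <= q)%E -> Lq_cvg q (algo j j' Xi f) f) in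
  (forall j, exists2 j', (j <= j')%N & recovers j j') /\
  (forall J : nat -> nat, (forall j, (j <= J j)%N /\ recovers j (J j)) ->
   forall Xi : forall j, 'I_(N (J j)).+1 -> Omega,
     (forall j, sampling_set Phi (Xi j)) ->
   forall f, Lq p%:E f ->
   exists2 g : nat -> Omega -> R,
     (forall j, Lq_cvg p%:E (algo j (J j) (Xi j) (P j f)) (g j)) &
     Lq_cvg p%:E g f).

Proof.
move=> Ocpt p1 V1 V2 V3 algo recovers.
have p1' : (1 <= p%:E)%E by rewrite lee_fin ltW.
(* The constant 1 lies in [V 0], hence in L^p by [MRA1]; this supplies the finite measure of
   [Omega]. *)
have L1 q : (1 <= q)%E -> Lq q (cst 1 : Omega -> R).
  by move=> q1; exact: (Lq_one p1 q1 (MRA1_Lq V1 p1 (MRA1_one V1))).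
have Vp j f : V j f -> Lq p%:E f by exact: (MRA1_Lq V1 p1).
have Vm j f : V j f -> measurable_fun setT (zero_ext f).
  by move=> /Vp/andP[+ _]; rewrite inE.
(* The second claim assumes recovery at the levels [J j], so it is settled independently of the
   first. *)
split=> [j|J JP Xi Xis f pf]; last first.
  exists (fun j => P j f); last exact: (MRA3_cvg V3 pf).
  move=> j; have [_ rec] := JP j.
  by have [_] := rec _ (Xis j) _ (MRA3_range V3 j pf); exact.
have [M PM] := MRA3_bounded V3 j.
(* Ensures [|M| * e <= 1/2], including when [M] is zero or negative. *)
pose e : R := 2^-1 / (`|M| + 1).
have M1 : 0 < `|M| + 1 by rewrite ltr_wpDl.
have e0 : 0 < e by rewrite divr_gt0// invr_gt0.
have [j' [jj' Sj']] := filter_ex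
  (filterI (nbhs_infty_ge j) (near_quasi_interp V2 Ocpt j e0)).
exists j' => // Xi Xis f Vf; have {}Sj' := Sj' Xi Xis.
have [bV _] := MRA2_basis V2 j.
pose S := quasi_interp Phi Xi.
have PSh g B : 0 <= B -> V j g -> (forall x, `|g x| <= B) ->
    forall x, `|g x - P j (S g) x| <= B / 2.
  move=> B0 Vg gB x.
  have SgB y : `|(S g - g) y| <= e * B by rewrite !fctE; exact: Sj'.
  have bSg : bounded (S g - g) by exists (e * B).
  have VSg : V j' (S g) := quasi_interp_in V2 Xi g.
  have pSg : Lq p%:E (S g - g).
    apply: (bounded_Lq p1' (L1 _ p1')) => //.
    by rewrite zero_extB; apply: measurable_funB; [exact: Vm VSg|exact: Vm Vg].
  (* As [P j] fixes [g], linearity turns [g - P j (S g)] into [- P j (S g - g)], to which the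
     sup-norm bound of [P j] applies. *)
  have PE : P j (S g - g) = P j (S g) - g.
    rewrite addrC -scaleN1r (MRA3_linear V3)//; [|exact: (Vp j)|exact: (Vp j')].
    by rewrite (MRA3_proj V3 Vg) scaleN1r addrC.
  have [bP PSM] := PM _ pSg bSg.
  have -> : g x - P j (S g) x = - P j (S g - g) x by rewrite PE !fctE opprB.
  rewrite normrN (le_trans (bounded_le_supnorm bP x))//.
  have s0 : 0 <= supnorm (S g - g).
    exact: le_trans (normr_ge0 _) (bounded_le_supnorm bSg x).
  have sB : supnorm (S g - g) <= e * B.
    by apply: supnorm_le => //; rewrite mulr_ge0// ltW.
  rewrite (le_trans PSM)// (le_trans (ler_wpM2r s0 (ler_norm M)))//.
  rewrite (le_trans (ler_wpM2l (normr_ge0 M) sB))// mulrA [leRHS]mulrC.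
  rewrite ler_wpM2r// /e mulrCA ler_piMr ?invr_ge0//.
  by rewrite ler_pdivrMr// mul1r lerDl.
have [B fB] := V_bounded V2 Vf.
have B0 : 0 <= `|B| by [].
have fB' x : `|f x| <= `|B| by rewrite (le_trans (fB x))// ler_norm.
have rec n : V j (algo j j' Xi f n) /\
    forall x, `|f x - algo j j' Xi f n x| <= `|B| / 2 ^+ n.+1.
  apply: (@reconstruction_error _ _ _ (V j)) => //.
  - by move=> g h; exact: (spansD bV).
  - by move=> g h; exact: (spansB bV).
  - move=> g Vg; apply: (MRA3_range V3); apply: (Vp j').
    exact: (quasi_interp_in V2).
have uf : {uniform, algo j j' Xi f n @[n --> \oo] --> f}.
  apply/uniform_cvgP => d' d'0.
  have geo : `|B| / 2 ^+ n.+1 @[n --> \oo] --> (0 : R).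
    rewrite -(mulr0 `|B|); apply: cvgMr.
    have -> : (fun n : nat => (2 ^+ n.+1)^-1 : R) = fun n => GRing.exp 2^-1 n.+1.
      by apply/funext => n; rewrite exprVn.
    rewrite (cvg_shiftS (GRing.exp (2^-1 : R))).
    by apply: cvg_expr; rewrite gtr0_norm ?invr_gt0// invf_lt1// ltr1n.
  have /cvgr0Pnorm_le/(_ _ d'0) := geo.
  apply: filterS => n nd x; have [_ /(_ x) h] := rec n.
  by rewrite (le_trans h)// (le_trans (ler_norm _)).
(* The iterates stay in [V j], which makes them measurable and bounded. *)
split => // q q1; apply: uniform_Lq_cvg => //.
- exact: L1.
- by move=> n; apply: (Vm j); have [] := rec n.
- by move=> n; apply: (V_bounded V2 (j := j)); have [] := rec n.
- exact: Vm Vf.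
- by exists B.
Qed.
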